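(* Let $N\ge 1$ be a natural number and let $F_N$ be the $N\times N$ unitary Fourier matrix, $[F_N]_{i,j}=\frac{1}{\sqrt N}e^{\mathbf i\frac{2\pi}{N}(i-1)(j-1)}$, $i,j\in\{1,\dots,N\}$. Then the defect of $F_N$ is $$\mathbf d(F_N)=\begin{cases}1-N+2\sum_{l=1}^{\frac{N-1}{2}}\gcd(N,l) & \text{for } N \text{ odd},\\[2mm] 1-\frac N2+2\sum_{l=1}^{\frac N2-1}\gcd(N,l) & \text{for } N\text{ even}.\end{cases}$$
   Context: Let $f$ be the map sending a complex $N\times N$ matrix $U$ to the real matrix $(|U_{i,j}|^2)_{i,j}$, regarded as a smooth map between real vector spaces, with differential at $U$ given by $Df_U(V)=\big(2\,\mathrm{Re}(\overline{U_{i,j}}V_{i,j})\big)_{i,j}$. For an $N\times N$ unitary matrix $U$ let $T_U=\{EU: E\in\mathbb C^{N\times N},\ E^*=-E\}$ be the (real) tangent space at $U$ to the manifold of unitary matrices. The defect of $U$ is the integer $\mathbf d(U)=(N-1)^2-\dim_{\mathbb R}Df_U(T_U)$. Empty sums are $0$. *)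

(* Defs.v *)
From HB Require Import structures.
From mathcomp Require Import all_boot all_order all_algebra.
From mathcomp Require Import complex ring.
From mathcomp Require Import all_classical all_reals all_analysis.

Set Implicit Arguments.
Unset Strict Implicit.
Unset Printing Implicit Defensive.

Import Order.TTheory GRing.Theory Num.Theory.
Local Open Scope ring_scope.
Local Open Scope complex_scope.

(* Complex matrices viewed as a real vector space: ['M[R[i]]_n] itself is only
   a module over [R[i]], so the [R]-structure is put on an alias. *)
Definition realmx (R : realType) (n : nat) : Type := 'M[R[i]]_n.

HB.instance Definition _ (R : realType) n := GRing.Zmodule.on (realmx R n).

Section RealMatrix.
Variables (R : realType) (n : nat).
Implicit Types (a b : R) (U V E : 'M[R[i]]_n).

Definition realmx_scale a (A : realmx R n) : realmx R n :=
  a%:C *: (A : 'M[R[i]]_n).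

Lemma realmx_scaleA a b A :
  realmx_scale a (realmx_scale b A) = realmx_scale (a * b) A.
Proof. by rewrite /realmx_scale scalerA rmorphM. Qed.

Lemma realmx_scale1 : left_id 1 realmx_scale.
Proof. by move=> A; rewrite /realmx_scale rmorph1 scale1r. Qed.

Lemma realmx_scaleDr : right_distributive realmx_scale +%R.
Proof. by move=> a A B; rewrite /realmx_scale scalerDr. Qed.

Lemma realmx_scaleDl A : {morph realmx_scale^~ A : a b / a + b}.
Proof. by move=> a b; rewrite /realmx_scale rmorphD scalerDl. Qed.

HB.instance Definition _ := GRing.Zmodule_isLmodule.Build R (realmx R n)
  realmx_scaleA realmx_scale1 realmx_scaleDr realmx_scaleDl.

Lemma realmx_linE a (A B : realmx R n) i j :
  (a *: A + B : 'M[R[i]]_n) i j =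
  a%:C * (A : 'M[R[i]]_n) i j + (B : 'M[R[i]]_n) i j.
Proof.
by rewrite -[LHS]/((a%:C *: (A : 'M[R[i]]_n) + (B : 'M[R[i]]_n)) i j) !mxE.
Qed.

Lemma Re_realM a (z : R[i]) : complex.Re (a%:C * z) = a * complex.Re z.
Proof. by case: z => x y /=; rewrite mul0r subr0. Qed.

Lemma Im_realM a (z : R[i]) : complex.Im (a%:C * z) = a * complex.Im z.
Proof. by case: z => x y /=; rewrite mul0r addr0. Qed.

Lemma realmx_vect_iso : Vector.axiom (n * n + n * n) (realmx R n).
Proof.
pose f (A : realmx R n) : 'rV[R]_(n * n + n * n) :=
  row_mx (mxvec (map_mx (@complex.Re R) (A : 'M[R[i]]_n)))
         (mxvec (map_mx (@complex.Im R) (A : 'M[R[i]]_n))).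
pose g (v : 'rV[R]_(n * n + n * n)) : realmx R n :=
  (\matrix_(i, j) Complex (vec_mx (lsubmx v) i j) (vec_mx (rsubmx v) i j)
   : 'M[R[i]]_n).
exists f.
  move=> a A B; rewrite /f scale_row_mx add_row_mx -!linearZ -!linearD /=.
  congr row_mx; congr mxvec; apply/matrixP => i j; rewrite !mxE.
  - by rewrite raddfD /= Re_realM.
  - by rewrite raddfD /= Im_realM.
exists g.
  move=> A; rewrite /g /f row_mxKl row_mxKr !mxvecK.
  by apply/matrixP => i j; rewrite !mxE; case: ((A : 'M[R[i]]_n) i j).
move=> v; rewrite /f /g -[RHS]hsubmxK.
by congr row_mx; apply: (can_inj vec_mxK); rewrite mxvecK;
  apply/matrixP => i j; rewrite 2!mxE.
Qed.

HB.instance Definition _ :=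
  Lmodule_hasFinDim.Build R (realmx R n) realmx_vect_iso.

Definition adjmx E : 'M[R[i]]_n := (map_mx (@conjc R) E)^T.

Definition sqmodmx U : 'M[R]_n :=
  \matrix_(i, j) (complex.Re (U i j) ^+ 2 + complex.Im (U i j) ^+ 2).

Lemma sqmodmxE U i j : (sqmodmx U i j)%:C = `|U i j| ^+ 2.
Proof.
rewrite mxE; case: (U i j) => x y.
by rewrite normc_def /= -rmorphXn sqr_sqrtr ?addr_ge0 ?sqr_ge0.
Qed.

Definition diff_sqmodmx_fun U (V : realmx R n) : 'M[R]_n :=
  \matrix_(i, j) (2 * complex.Re ((U i j)^* * (V : 'M[R[i]]_n) i j)).

Fact diff_sqmodmx_is_linear U : linear (diff_sqmodmx_fun U).
Proof.
move=> a A B; apply/matrixP => i j; rewrite !mxE.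
by rewrite mulrDr raddfD /= mulrCA Re_realM mulrDr mulrCA.
Qed.

HB.instance Definition _ U := GRing.isLinear.Build R (realmx R n) 'M[R]_n _
  (diff_sqmodmx_fun U) (diff_sqmodmx_is_linear U).

Definition diff_sqmodmx U : 'Hom(realmx R n, 'M[R]_n) :=
  linfun (diff_sqmodmx_fun U).

Lemma diff_sqmodmxE U V i j :
  diff_sqmodmx U V i j = 2 * complex.Re ((U i j)^* * V i j).
Proof. by rewrite lfunE mxE. Qed.

(* [diff_sqmodmx U] is the linear part of the quadratic map [sqmodmx] at [U]. *)
Lemma sqmodmxD U V :
  sqmodmx (U + V) = sqmodmx U + diff_sqmodmx U V + sqmodmx V.
Proof.
apply/matrixP => i j; rewrite mxE [in RHS]mxE [in RHS]mxE diff_sqmodmxE !mxE.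
case: (U i j) (V i j) => [a b] [c d] /=; ring.
Qed.

Definition hermpart (E : realmx R n) : realmx R n :=
  (adjmx E + (E : 'M[R[i]]_n))%R.

Fact hermpart_is_linear : linear hermpart.
Proof.
move=> a A B; apply/matrixP => i j; rewrite !mxE.
rewrite rmorphD rmorphM /= oppr0 mulrDr !addrA; congr (_ + _).
by rewrite -!addrA; congr (_ + _); rewrite addrC.
Qed.

HB.instance Definition _ := GRing.isLinear.Build R (realmx R n) (realmx R n) _
  hermpart hermpart_is_linear.

Definition skew_herm : {vspace realmx R n} := lker (linfun hermpart).

Lemma skew_hermP E : reflect (adjmx E = - E) ((E : realmx R n) \in skew_herm).
Proof.
rewrite /skew_herm memv_ker lfunE /= /hermpart addr_eq0. exact: eqP.
Qed.

Definition mulmxr_real U (E : realmx R n) : realmx R n :=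
  (E : 'M[R[i]]_n) *m U.

Fact mulmxr_real_is_linear U : linear (mulmxr_real U).
Proof.
move=> a A B; rewrite /mulmxr_real mulmxDl; congr (_ + _).
exact/esym/(scalemxAl a%:C (A : 'M[R[i]]_n) U).
Qed.

HB.instance Definition _ U := GRing.isLinear.Build R
  (realmx R n) (realmx R n) _ (mulmxr_real U) (mulmxr_real_is_linear U).

Definition tangent U : {vspace realmx R n} :=
  (linfun (mulmxr_real U) @: skew_herm)%VS.

Lemma tangentP U V :
  (V : realmx R n) \in tangent U <->
  exists2 E : 'M[R[i]]_n, adjmx E = - E & V = E *m U.
Proof.
split=> [/memv_imgP[E /skew_hermP sE ->]|[E /skew_hermP sE ->]].
  by exists E => //; rewrite lfunE.
by apply/memv_imgP; exists E => //; rewrite lfunE.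
Qed.

Definition defect U : int :=
  (n%:Z - 1) ^+ 2 - (\dim (diff_sqmodmx U @: tangent U)%VS)%:Z.

End RealMatrix.

Definition expi (R : realType) (t : R) : R[i] := cos t +i* sin t.

(* Indices start at 0, hence no shift by 1 in the exponent. *)
Definition Fourier (R : realType) (n : nat) : 'M[R[i]]_n :=
  \matrix_(i, j) ((Num.sqrt n%:R)^-1%:C
                  * expi (2 * pi / n%:R * (i%:R * j%:R))).

(* Main.v *)
From HB Require Import structures.
Require Import Defs.
From mathcomp Require Import all_boot all_order all_algebra.
From mathcomp Require Import complex ring lra zify.
From mathcomp Require Import all_classical all_reals all_analysis.

(** Real matrices [A] parametrize the skew-hermitian ones by
    [E = (A - A^T) + i (A + A^T)].  For such [E], up to an invertible discrete
    Fourier transform along the rows, [Df_F (E F)] is the array of the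
    [E_{k,m} - E_{2k-m,k}] (indices mod [N]).  Hence the kernel of
    [A |-> Df_F (E F)] consists of the [A] for which [A_{k,k+d}], as a function
    of [k], is invariant under [k |-> k + d]: it depends only on [d] and on [k]
    mod [gcd(N,d)], so the kernel has dimension [sum_{d < N} gcd(N,d)], and
    rank-nullity gives the dimension of the image. *)

Local Open Scope ring_scope.
Import Order.TTheory GRing.Theory Num.Theory.

(** * Folding sums of gcds *)

Lemma sum_nat_reflect (F : nat -> nat) (a k : nat) :
  (\sum_(a.+1 <= d < (a + k).+1) F d =
   \sum_(1 <= l < k.+1) F ((a + k).+1 - l))%N.
Proof.
rewrite big_nat_rev /= -{1}[a.+1]add1n big_addn (_ : (_ - a = k.+1)%N); last lia.
apply: eq_big_nat => l hl; congr F; lia.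
Qed.

Lemma gcdn_subr (n l : nat) : (l <= n)%N -> gcdn n (n - l) = gcdn n l.
Proof.
move=> le_ln; rewrite gcdnC [RHS]gcdnC.
by rewrite -{2}(subnKC le_ln) -{3}(subnK le_ln) !gcdnDr gcdnC.
Qed.

(** The reflection [d |-> N - d] preserves [gcd(N,d)] and exchanges the two halves of the range. *)
Lemma sum_gcdn_odd (h : nat) :
  (\sum_(1 <= d < h.*2.+1) gcdn h.*2.+1 d =
   2 * \sum_(1 <= l < h.+1) gcdn h.*2.+1 l)%N.
Proof.
rewrite (@big_cat_nat _ _ _ h.+1) /=; [|lia..].
rewrite mul2n -[RHS]addnn -{2}addnn sum_nat_reflect; congr addn.
by apply: eq_big_nat => l hl; rewrite addnn gcdn_subr //; lia.
Qed.

(** Here the reflection fixes [d = N/2], whose gcd with [N] is the isolated term [h.+1]. *)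
Lemma sum_gcdn_even (h : nat) :
  (\sum_(1 <= d < h.+1.*2) gcdn h.+1.*2 d =
   h.+1 + 2 * \sum_(1 <= l < h.+1) gcdn h.+1.*2 l)%N.
Proof.
rewrite (@big_cat_nat _ _ _ h.+1) /=; [|lia..].
rewrite [X in (_ + X)%N]big_ltn; last lia.
rewrite -{2}mul2n gcdnC gcdnMl addnCA mul2n -[in RHS]addnn.
have e : h.+1.*2 = (h.+1 + h).+1 by lia.
rewrite [in X in (_ + (_ + X))%N]e sum_nat_reflect -e; congr (_ + (_ + _))%N.
by apply: eq_big_nat => l hl; rewrite gcdn_subr //; lia.
Qed.

(** * Roots of unity from the real sine and cosine *)

Section RootOfUnity.
Context {R : realType}.
Implicit Types s t : R.

Lemma expiD s t : expi (s + t) = expi s * expi t.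
Proof.
rewrite /expi cosD sinD; apply/eqP; rewrite eq_complex /= addrC.
by apply/andP; split; apply/eqP; ring.
Qed.

Lemma expi0 : expi 0 = 1 :> R[i].
Proof. by rewrite /expi cos0 sin0. Qed.

Lemma expiMn t n : expi (t * n%:R) = expi t ^+ n.
Proof.
elim: n => [|n IHn]; first by rewrite mulr0 expi0.
by rewrite exprS -IHn -expiD -nat1r mulrDr mulr1.
Qed.

Lemma conjc_expi t : (expi t)^*%C * expi t = 1.
Proof.
apply/eqP; rewrite eq_complex /=; have := cos2Dsin2 t; rewrite !expr2 => h.
by apply/andP; split; apply/eqP; [lra|ring].
Qed.

(** The real part is [1 - 2 sin(t/2)^2], and [sin] is positive on the open interval from 0 to
    [pi]. *)
Lemma expi_neq1 t : 0 < t < 2 * pi -> expi t != 1.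
Proof.
move=> /andP[t0 t1].
have /sin_gt0_pi s0 : 0 < t / 2 < pi by apply/andP; split; lra.
have -> : t = (t / 2) *+ 2 by rewrite -mulr_natr; lra.
rewrite eq_complex negb_and /=.
rewrite cos_mulr2n cos2sin2; apply/orP; left; rewrite lt_eqF //.
have := exprn_gt0 2 s0; rewrite -mulr_natr; lra.
Qed.

Lemma expi_primitive n : n.+1.-primitive_root (expi (2 * pi / n.+1%:R) : R[i]).
Proof.
have n0 : n.+1%:R != 0 :> R by rewrite pnatr_eq0.
apply/andP; split=> //; apply/forallP => i; rewrite unity_rootE -expiMn.
case: (eqVneq i.+1 n.+1) => [->|ni]; apply/eqP.
  by apply/eqP; rewrite (divfK n0) /expi mulr_natl cos2pi sin2pi.
apply/negbTE/expi_neq1; have i0 : (0 < i.+1%:R :> R) by rewrite ltr0n.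
have hn : (0 < n.+1%:R :> R) by rewrite ltr0n.
have p0 := pi_gt0 R.
rewrite mulrAC !divr_gt0 ?mulr_gt0 //= ltr_pdivrMr // ltr_pM2l ?mulr_gt0 //.
by rewrite ltr_nat ltn_neqAle ni ltn_ord.
Qed.
End RootOfUnity.

(** * Dimension counts *)

Lemma dim_ffun (K : fieldType) (I : finType) : dim {ffun I -> K^o} = #|I|.
Proof. exact: muln1. Qed.

Lemma dim_limg_exact (K : fieldType) (aT vT rT : vectType K)
  (f : 'Hom(aT, vT)) (g : 'Hom(vT, rT)) :
  lker f = 0%VS -> lker g = limg f -> (dim aT + \dim (limg g))%N = dim vT.
Proof.
move=> f0 gf; rewrite -!dimvf -(limg_dim_eq (f := f)) ?f0 ?capv0 // -gf.
by rewrite -(limg_ker_dim g fullv) capfv.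
Qed.

Lemma card_residues (n : nat) :
  #|{: {d : 'I_n & 'I_(gcdn n d)}}| = (\sum_(d < n) gcdn n d)%N.
Proof.
rewrite card_tagged sumnE big_map big_enum /=; apply: eq_bigr => d _.
by rewrite card_ord.
Qed.

(** * Matrices invariant along the orbits of the translations [k |-> k + d] *)

Section Orbits.
Context {K : fieldType} {n : nat}.
Local Notation I := {d : 'I_n.+1 & 'I_(gcdn n.+1 d)}.

Fact gcdn_ord_gt0 (d : 'I_n.+1) : (0 < gcdn n.+1 d)%N.
Proof. by rewrite gcdn_gt0. Qed.

(** Label of the orbit of [k] under translation by [d]. The tagged type has exactly one element per
    orbit, so its cardinality is the sum of gcds. *)
Definition residue (d k : 'I_n.+1) : I :=
  Tagged (fun d : 'I_n.+1 => 'I_(gcdn n.+1 d))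
    (Ordinal (ltn_pmod k (gcdn_ord_gt0 d))).

Definition spread_fun (b : {ffun I -> K^o}) : 'M[K]_n.+1 :=
  \matrix_(k, m) b (residue (m - k) k).

Fact spread_is_linear : linear spread_fun.
Proof. by move=> a b c; apply/matrixP => k m; rewrite !mxE !ffunE. Qed.

HB.instance Definition _ := GRing.isLinear.Build K {ffun I -> K^o} 'M[K]_n.+1 _
  spread_fun spread_is_linear.

Definition spread : 'Hom({ffun I -> K^o}, 'M[K]_n.+1) := linfun spread_fun.

(** Every label is attained: [(d, r)] is the one used at the entry [(r, r + d)]. *)
Lemma lker_spread : lker spread = 0%VS.
Proof.
apply/eqP; rewrite -subv0; apply/subvP => b; rewrite memv_ker lfunE /= memv0.
move=> /eqP /matrixP b0; apply/eqP/ffunP => -[d r]; rewrite ffunE.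
have dn : (gcdn n.+1 d <= n.+1)%N by rewrite dvdn_leq // dvdn_gcdl.
pose k := widen_ord dn r.
have := b0 k (k + d); rewrite !mxE addrAC subrr add0r => <-; congr (b _).
by congr Tagged; apply/val_inj; rewrite /= modn_small.
Qed.

Lemma residue_step (d k : 'I_n.+1) : residue d (k + d) = residue d k.
Proof.
congr Tagged; apply/val_inj => /=.
rewrite modn_dvdm ?dvdn_gcdl // -modnDmr.
by rewrite (eqP (dvdn_gcdr _ _)) addn0.
Qed.

Lemma val_mulrn_ord (d : 'I_n.+1) t : (d *+ t)%R = ((t * d) %% n.+1)%N :> nat.
Proof.
elim: t => [|t IHt]; first by rewrite mod0n.
by rewrite mulrS /= IHt modnDmr mulSn.
Qed.

(* By Bezout, [d] generates the multiples of [gcd(n.+1,d)] mod [n.+1]. *)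
Lemma residue_reach (d k : 'I_n.+1) :
  exists t, val (k + d *+ t) = (k %% gcdn n.+1 d)%N.
Proof.
have [a _ /dvdnP[q hq]] := Bezoutl d (ltn0Sn n).
(* Bezout gives [a * d = - g] mod [n.+1], so this many steps cancel the part [(k %/ g) * g] of [k]
   and leave its remainder. *)
exists (k %/ gcdn n.+1 d * a)%N; set g := gcdn _ _ in hq *.
rewrite /= val_mulrn_ord modnDmr {1}(divn_eq k g) addnAC -mulnA -mulnDr hq mulnA.
rewrite modnMDl modn_small // (leq_trans (ltn_pmod _ (gcdn_ord_gt0 d))) //.
by rewrite dvdn_leq // dvdn_gcdl.
Qed.

Lemma limg_spreadP (A : 'M[K]_n.+1) :
  reflect (forall d k, A (k + d) (k + d + d) = A k (k + d))
    (A \in limg spread).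
Proof.
apply: (iffP memv_imgP) => [[b _ ->] d k | invA].
  rewrite lfunE /= !mxE [k + d + d]addrC addrK [k + d - k]addrAC subrr add0r.
  by rewrite residue_step.
(* Read [A] at the least representative of each orbit; it is below [gcd(n.+1,d) <= n.+1], so [inord]
   never takes its default value. *)
exists [ffun i : I => A (inord (tagged i)) (inord (tagged i) + tag i)].
  by rewrite memvf.
rewrite lfunE /=; apply/matrixP => k m; rewrite !mxE ffunE /=.
set d := m - k; have [t kt] := residue_reach d k.
rewrite -kt inord_val.
have -> : m = k + d by rewrite addrC subrK.
clearbody d; clear kt; elim: t => [|t ->]; first by rewrite addr0.
by rewrite mulrSr addrA invA.
Qed.
End Orbits.

(** * The differential at the Fourier matrix and its kernel *)

Section FourierDifferential.
Context {R : realType} {n : nat}.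
Local Notation N := n.+1.
Local Notation C := R[i].
Local Notation F := (Fourier R N).

Definition omega : C := expi (2 * pi / N%:R).
Definition chi (k : 'I_N) : C := omega ^+ k.

Lemma chiD k l : chi (k + l) = chi k * chi l.
Proof. by rewrite /chi /= prim_expr_mod ?exprD //; exact: expi_primitive. Qed.

Lemma conjc_chi k : (chi k)^*%C * chi k = 1.
Proof. by rewrite /chi rmorphXn -exprMn conjc_expi expr1n. Qed.

Lemma chi_neq0 k : chi k != 0.
Proof.
by apply/eqP => k0; have /eqP := conjc_chi k; rewrite k0 mulr0 eq_sym oner_eq0.
Qed.

Lemma conjc_chiE k : (chi k)^*%C = chi (- k).
Proof.
apply: (mulIf (chi_neq0 k)); rewrite conjc_chi -chiD addNr /chi /=.
by rewrite expr0.
Qed.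

(** As [chi m ^+ j = chi j ^+ m], the polynomial with coefficients [c], of degree below [N],
    vanishes at the [N] distinct points [chi j]. *)
Lemma dft_inj (c : 'I_N -> C) :
  (forall j : 'I_N, \sum_m c m * chi m ^+ j = 0) -> forall m, c m = 0.
Proof.
move=> c0; pose p := \poly_(i < N) c (inord i).
have p0 : p = 0.
  apply/eqP/negP => /negP p_neq0.
  have rts : all (root p) [seq chi j | j <- enum 'I_N].
    apply/allP => _ /mapP[j _ ->]; rewrite rootE horner_poly; apply/eqP.
    rewrite -[RHS](c0 j); apply: eq_bigr => m _.
    by rewrite inord_val /chi -!exprM mulnC.
  have := max_poly_roots p_neq0 rts.
  rewrite map_inj_uniq ?enum_uniq => [/(_ isT)|i j /eqP].
    by rewrite size_map size_enum_ord ltnNge size_poly.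
  rewrite /chi (eq_prim_root_expr (expi_primitive n)) !modn_small //.
  by move/eqP/val_inj.
move=> m; have := congr1 (fun q : {poly C} => q`_m) p0.
by rewrite coef_poly ltn_ord inord_val coef0.
Qed.

Lemma FourierE k j : F k j = (Num.sqrt N%:R)^-1%:C%C * chi k ^+ j.
Proof.
by rewrite mxE /chi /omega -exprM -expiMn natrM.
Qed.

(* [realmx] alone is MathComp's real-entries predicate. *)
Definition skew_of_fun (A : 'M[R]_N) : Defs.realmx R N :=
  \matrix_(k, m) Complex (A k m - A m k) (A k m + A m k).

Fact skew_of_is_linear : linear skew_of_fun.
Proof.
move=> a A B; apply/matrixP => k m; rewrite realmx_linE !mxE.
by apply/eqP; rewrite eq_complex /=; apply/andP; split; apply/eqP; ring.
Qed.

HB.instance Definition _ := GRing.isLinear.Build R 'M[R]_N (Defs.realmx R N) _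
  skew_of_fun skew_of_is_linear.

Definition skew_of : 'Hom('M[R]_N, Defs.realmx R N) := linfun skew_of_fun.

Lemma limg_skew_of : limg skew_of = skew_herm R N.
Proof.
apply/vspaceP => E; apply/memv_imgP/skew_hermP => [[A _ ->]|sE].
  rewrite lfunE; apply/matrixP => k m; rewrite !mxE.
  by apply/eqP; rewrite eq_complex /=; apply/andP; split; apply/eqP; ring.
(* For skew-hermitian [E] the real part is antisymmetric and the imaginary part symmetric, so this
   sum determines both. *)
exists (\matrix_(k, m) ((complex.Re (E k m) + complex.Im (E k m)) / 2)).
  by rewrite memvf.
rewrite lfunE; apply/matrixP => k m; rewrite !mxE.
have := congr1 (fun M : 'M[C]_N => M k m) sE; rewrite !mxE.
case: (E k m) (E m k) => [a b] [c d] /= /eqP.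
rewrite eq_complex /= => /andP[/eqP h1 /eqP h2].
by apply/eqP; rewrite eq_complex /=; apply/andP; split; apply/eqP; lra.
Qed.

Definition fourier_diff : 'Hom('M[R]_N, 'M[R]_N) :=
  (diff_sqmodmx F \o (linfun (mulmxr_real F) \o skew_of))%VF.

Lemma limg_fourier_diff : limg fourier_diff = (diff_sqmodmx F @: tangent F)%VS.
Proof. by rewrite !limg_comp limg_skew_of. Qed.

(** Write [2 Re z] as [z + z^*]. Skew-hermitian symmetry turns the conjugate of row [k] into minus
    column [k], and the factor [N] absorbs the two normalizations [1/sqrt N]. *)
Lemma fourier_diffE (A : 'M[R]_N) k j :
  (N%:R * fourier_diff A k j)%:C%C =
  chi (- k) ^+ j *
  \sum_m (skew_of A k m - skew_of A (k + k - m) k) * chi m ^+ j.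
Proof.
set E := skew_of A; have skewE k' m' : (E k' m')^*%C = - E m' k'.
  have /skew_hermP sE : E \in skew_herm R N by rewrite -limg_skew_of memv_img ?memvf.
  by have := congr1 (fun M : 'M[C]_N => M m' k') sE; rewrite !mxE.
have conjCE (z : C) : Num.conj z = z^*%C by [].
have Re2 (z : C) : (2 * complex.Re z)%:C%C = z + z^*%C.
  case: z => a b; apply/eqP; rewrite eq_complex /=.
  by apply/andP; split; apply/eqP; ring.
pose s : C := (Num.sqrt N%:R)^-1%:C%C.
have Ns2 : N%:R * (s * s) = 1.
  rewrite -rmorphM -invfM -expr2 sqr_sqrtr ?ler0n //.
  by rewrite -(rmorph_nat (real_complex R)) -rmorphM mulfV ?rmorph1 // pnatr_eq0.
have conj_s : s^*%C = s by rewrite /s /= oppr0.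
have FE k' m' : F k' m' = s * chi k' ^+ m' by exact: FourierE.
clearbody s.
have -> : fourier_diff A k j =
    2 * complex.Re (chi (- k) ^+ j * (s * s) * \sum_m E k m * chi m ^+ j).
  rewrite lfunE /= diff_sqmodmxE lfunE /= lfunE /= FE /mulmxr_real mxE.
  congr (2 * complex.Re _); rewrite rmorphM rmorphXn /= !conjCE conj_s.
  rewrite conjc_chiE [s * _ in LHS]mulrC -!mulrA; congr (_ * (_ * _)).
  rewrite mulr_sumr; apply: eq_bigr => m _; rewrite FE; ring.
rewrite rmorphM /= Re2 rmorph_nat.
set S := \sum_m _; set T := RHS.
(* Reindexing by the involution [m |-> 2k - m]. *)
have conjS : S^*%C = - (chi (- k) ^+ j * chi (- k) ^+ j) *
    \sum_m E (k + k - m) k * chi m ^+ j.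
  rewrite rmorph_sum mulr_sumr (reindex_inj (can_inj (subKr (k + k)))) /=.
  apply: eq_bigr => m _; rewrite rmorphM rmorphXn /= skewE.
  rewrite conjc_chiE opprB !chiD opprD !chiD !exprMn; ring.
rewrite !rmorphM rmorphXn /= conj_s conjc_chiE opprK conjS /T.
under [X in _ = _ * X]eq_bigr do rewrite mulrBl.
rewrite sumrB -/S; set S' := \sum_m _.
have ck : chi k ^+ j * chi (- k) ^+ j = 1.
  by rewrite -exprMn -chiD subrr /chi expr0 expr1n.
transitivity (N%:R * (s * s) *
    (chi (- k) ^+ j * (S - chi k ^+ j * chi (- k) ^+ j * S'))).
  ring.
by rewrite Ns2 ck !mul1r.
Qed.

Lemma lker_fourier_diffP (A : 'M[R]_N) :
  reflect (forall d k, A (k + d) (k + d + d) = A k (k + d))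
    (A \in lker fourier_diff).
Proof.
rewrite memv_ker; apply: (iffP eqP) => [A0 d k | invA].
  have /dft_inj E0 (j : 'I_N) :
      \sum_m (skew_of A (k + d) m - skew_of A (k + d + (k + d) - m) (k + d)) *
             chi m ^+ j = 0.
    apply: (mulfI (expf_neq0 j (chi_neq0 (- (k + d))))).
    rewrite mulr0; have := fourier_diffE A (k + d) j.
    by rewrite A0 mxE mulr0 => /esym.
  (* This index reflects to [k] through [k + d]; adding the real and imaginary parts of the equation
     isolates the entries of [A]. *)
  have := E0 (k + d + d).
  rewrite (_ : k + d + (k + d) - (k + d + d) = k); last first.
    by apply/eqP; rewrite subr_eq -!addrA [d + (k + d)]addrCA.
  rewrite lfunE !mxE => /eqP.
  by rewrite eq_complex /= => /andP[/eqP h1 /eqP h2]; lra.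
apply/matrixP => k j; rewrite mxE.
apply: (mulfI (_ : N%:R != 0)); first by rewrite pnatr_eq0.
apply: (@complexI R).
rewrite mulr0 fourier_diffE big1 ?mulr0 // => m _.
(* The opposite steps [m - k] and [k - m] give [A k m = A (2k-m) k] and [A k (2k-m) = A m k], which
   cancel the [m]-th coefficient. *)
have := invA (m - k) (k + k - m); have := invA (k - m) m.
rewrite (_ : m + (k - m) = k); last by rewrite addrC subrK.
rewrite (_ : k + k - m + (m - k) = k); last by rewrite addrA subrK addrK.
rewrite addrA (_ : k + (m - k) = m); last by rewrite addrC subrK.
by rewrite lfunE !mxE => h1 h2; rewrite -h1 -h2 subrr mul0r.
Qed.

End FourierDifferential.

(** * Rank-nullity and the value of the defect *)

Lemma dim_tangent_image (R : realType) (n : nat) :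
  (\sum_(d < n.+1) gcdn n.+1 d
   + \dim (diff_sqmodmx (Fourier R n.+1) @: tangent (Fourier R n.+1)))%N
  = (n.+1 * n.+1)%N.
Proof.
rewrite -limg_fourier_diff -card_residues -(dim_ffun R).
have <- : dim 'M[R]_n.+1 = (n.+1 * n.+1)%N by exact: dim_matrix.
apply: (@dim_limg_exact _ _ _ _ spread); first exact: lker_spread.
by apply/vspaceP => A; apply/lker_fourier_diffP/limg_spreadP.
Qed.

Theorem theorem5p2 (R : realType) (N : nat) (hN : (1 <= N)%N) :
  defect (Fourier R N) =
    (if odd N then
       1 - N%:Z + 2 * \sum_(1 <= l < (N.-1./2).+1) (gcdn N l)%:Z
     else
       1 - (N./2)%:Z + 2 * \sum_(1 <= l < (N./2.-1).+1) (gcdn N l)%:Z) :> int.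
Proof.
case: N hN => // n _; rewrite /defect.
have := dim_tangent_image R n; set D := \dim _.
(* The term [d = 0] equals [N], so the defect is [1 - N] plus the sum over [1 <= d < N]. *)
rewrite -(big_mkord xpredT (gcdn n.+1)) big_ltn // gcdn0 => dimD.
rewrite -!(big_morph Posz PoszD (erefl 0%:Z)).
case: ifP => [odd_n | even_n].
- have [h nE] : exists h, n = h.*2.
    exists n./2; rewrite -[n in LHS]odd_double_half.
    by move: odd_n => /= /negbTE ->.
  move: dimD; rewrite nE sum_gcdn_odd /= doubleK.
  set S := (\sum_(1 <= i < _) _)%N; nia.
- have [h nE] : exists h, n = h.*2.+1.
    exists n./2; rewrite -[n in LHS]odd_double_half.
    by move: even_n => /= /negbFE ->.
  move: dimD; rewrite nE -doubleS sum_gcdn_even doubleK /=.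
  set S := (\sum_(1 <= i < _) _)%N; nia.
Qed.
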